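(* Let $\mathcal{C}$ be any of the chains $\mathcal{C}_\alpha$, $\mathcal{C}_\beta$, $\mathcal{C}_\gamma$ described in the context, and let $i,j,n$ be integers with $i\neq j$. If $i+j\neq 0$, then $d_{i,j}(n)=f_{i,j}(n)\,r_n$ holds, where $$f_{i,j}(n)=\frac{2(n-i)(n-j)}{i+j}.$$
   Context: Let $C$ be a point on a segment $AB$, and let $\alpha$, $\beta$, $\gamma$ be the circles with diameters $BC$, $CA$, $AB$, respectively. Let $a$ and $b$ be the radii of $\alpha$ and $\beta$, and let $c=a+b$. Use rectangular coordinates with origin $C$ such that $A=(-2b,0)$ and $B=(2a,0)$. For $\varepsilon_1\in\{\alpha,\beta,\gamma\}$ let $\varepsilon_2,\varepsilon_3$ be the other two circles; the chain $\mathcal{C}_{\varepsilon_1}=\{\dots,\delta_{-2},\delta_{-1},\delta_0,\delta_1,\delta_2,\dots\}$ is the two-sided chain of distinct circles, indexed by the integers, with $\delta_0=\varepsilon_1$, whose members all touch $\varepsilon_2$ and $\varepsilon_3$ and in which $\delta_n$ touches $\delta_{n+1}$ for every integer $n$. Let $(x_n,y_n)$ be the center and $r_n$ the radius of $\delta_n$; they are given by $y_n=2nr_n$ and: - for $\mathcal{C}_\alpha$: $x_n=-2b+\dfrac{bc(b+c)}{n^2a^2+bc}$, $r_n=\dfrac{abc}{n^2a^2+bc}$; - for $\mathcal{C}_\beta$: $x_n=2a-\dfrac{ca(c+a)}{n^2b^2+ca}$, $r_n=\dfrac{abc}{n^2b^2+ca}$; - for $\mathcal{C}_\gamma$: $x_n=\dfrac{ab(b-a)}{n^2c^2-ab}$,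 $r_n=\dfrac{abc}{n^2c^2-ab}$. For $i\neq j$, $l_{i,j}$ is the line passing through the centers of the circles $\delta_i$ and $\delta_j$ of the chain. $H_{i,j}(n)$ is the point of intersection of the lines $l_{i,j}$ and $x=x_n$, $h_{i,j}(n)$ is the $y$-coordinate of $H_{i,j}(n)$, and $d_{i,j}(n)=h_{i,j}(n)-y_n$, i.e., $d_{i,j}(n)$ is the signed distance between the center of $\delta_n$ and $H_{i,j}(n)$.
   Formalization: For the chain C_γ the case a = b is excluded: there all x_n are 0, so the line l_{i,j} coincides with x = x_n and the point H_{i,j}(n), hence d_{i,j}(n), is undefined. *)

(* Defs.v *)
From HB Require Import structures.
From mathcomp Require Import all_boot all_order all_algebra.
Set Implicit Arguments.
Unset Strict Implicit.
Unset Printing Implicit Defensive.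
Import Order.TTheory GRing.Theory Num.Theory.
Local Open Scope ring_scope.

Definition point (R : rcfType) : Type := (R * R)%type.

(* A circle is a pair (center, radius); positivity of the radius is imposed
   where circles are quantified over, in [is_chain]. *)
Definition circle (R : rcfType) : Type := (point R * R)%type.

Definition center (R : rcfType) (K : circle R) : point R := K.1.
Definition radius (R : rcfType) (K : circle R) : R := K.2.

Definition on_circle (R : rcfType) (K : circle R) (P : point R) : Prop :=
  (P.1 - (center K).1) ^+ 2 + (P.2 - (center K).2) ^+ 2 = radius K ^+ 2.

(* Internal and external tangency alike; a circle of positive radius does not
   touch itself. *)
Definition touch (R : rcfType) (K L : circle R) : Prop :=
  exists! P : point R, on_circle K P /\ on_circle L P.

Variant arbelos_label := Alpha | Beta | Gamma.

(* With C = (0, 0), A = (-2b, 0) and B = (2a, 0), these are the circles with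
   diameters BC, CA and AB. *)
Definition arbelos_circle (R : rcfType) (a b : R) (e : arbelos_label)
    : circle R :=
  match e with
  | Alpha => ((a, 0), a)
  | Beta => ((- b, 0), b)
  | Gamma => ((a - b, 0), a + b)
  end.

(* Reflection in the line AB reverses the numbering of a chain, so the touching
   conditions determine it only up to n |-> - n; the last condition selects the
   numbering for which the centers satisfy y_n = 2 n r_n. *)
Definition is_chain (R : rcfType) (a b : R) (e : arbelos_label)
    (delta : int -> circle R) : Prop :=
  [/\ (forall n, 0 < radius (delta n)) /\ injective delta,
      delta 0 = arbelos_circle a b e,
      forall n e', e' <> e -> touch (delta n) (arbelos_circle a b e'),
      forall n, touch (delta n) (delta (n + 1))
    & 0 < (center (delta 1)).2].

(* r_n is a signed radius: the circle gamma, which surrounds alpha and beta,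
   counts negatively.  This affects only delta_0 in the chain starting at gamma,
   where r_n = abc / (n^2 c^2 - ab) takes the value - c at n = 0. *)
Definition chain_radius (R : rcfType) (a b : R) (delta : int -> circle R)
    (n : int) : R :=
  if delta n == arbelos_circle a b Gamma then - radius (delta n)
  else radius (delta n).

Definition on_line (R : rcfType) (P Q X : point R) : Prop :=
  (Q.1 - P.1) * (X.2 - P.2) = (Q.2 - P.2) * (X.1 - P.1).

(* H is the one and only common point of l_{i,j} and the line x = x_n. *)
Definition is_H (R : rcfType) (delta : int -> circle R) (i j n : int)
    (H : point R) : Prop :=
  forall X : point R,
    on_line (center (delta i)) (center (delta j)) X /\
    X.1 = (center (delta n)).1 <-> X = H.

Definition signed_dist (R : rcfType) (delta : int -> circle R) (n : int)
    (H : point R) : R :=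
  H.2 - (center (delta n)).2.

Definition chain_coef (R : rcfType) (i j n : int) : R :=
  (2 * (n - i) * (n - j))%:~R / (i + j)%:~R.

(* Main.v *)
Require Import Defs.
From mathcomp Require Import all_boot all_order all_algebra.
From mathcomp Require Import ring lra zify.
Import Order.TTheory GRing.Theory Num.Theory.
Local Open Scope ring_scope.
Set Implicit Arguments.
Unset Strict Implicit.

(** The two circles other than the starting one touch each other at a point T
    of the line AB: at A, B or C for the chain starting at alpha, beta or
    gamma.  With T = (t, 0) they are the circles of radii |p| and |q| centered
    at (t + p, 0) and (t + q, 0), where p and q are signed, so one computation
    covers the three chains.

    Inversion at T turns these two circles into parallel lines, hence a circle
    touching both either passes through T (and becomes a third parallel) or
    becomes a circle inscribed in the strip between them.  The inscribed circles
    are all congruent and depend on one parameter, their height m, normalized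
    so that neighbours in contact differ by 1; a parallel can touch an inscribed
    circle only along the boundary of the strip.  So the chain moves up by one
    step each time, never turning back because its members are distinct, and
    the parameter of delta_n is n.  The proof carries this out without the
    inversion, through polynomial identities: [touch_dist] translates tangency
    into an equation between center distance and radii, [touch_pencil2] is the
    dichotomy, [chain_neighbour] is the unit step and [tangency_chainE] the
    induction.

    With w the signed width satisfying w^2 = (p - q)^2 and the ratio
    k_n = pq / (pq + n^2 w^2), the center of delta_n is
    (t + (p + q) k_n, 2 n w k_n) and its signed radius is w k_n.  The offset
    formula ([chain_offset]) comes from the identity
      2 n w k + 2 (n - i) (n - j) / (i + j) w k = 2 w / (i + j) (n^2 + i j) k
    and from n^2 w^2 k_n = pq (1 - k_n), which make the right-hand side an
    affine function of k_n, hence of the abscissa x_n.  For n = i and n = j the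
    second term on the left vanishes, so the graph of this affine function
    passes through the centers of delta_i and delta_j: it is the line l_{i,j},
    and the second term is the signed distance sought. *)

(** * Tangency as an equation between radii and center distance *)

Lemma touch_sym (R : rcfType) (K L : circle R) : touch K L -> touch L K.
Proof.
move=> [P [[KP LP] uniqP]]; exists P; split=> // Q [LQ KQ].
by apply: uniqP.
Qed.

(** If the centers coincide, the half-turn about them maps a common point to a
    common point, so a unique common point would be the center itself. *)
Lemma touch_center_neq (R : rcfType) (K L : circle R) :
  0 < radius K -> touch K L -> center K <> center L.
Proof.
case: K => [[x y] r]; case: L => [[x' y'] r'].
rewrite /touch /on_circle /center /radius /= => r_gt0.
move=> [[u v] /= [[KP LP] uniqP]] [ex ey]; subst x' y'.
have /pair_equal_spec[eu ev] : (u, v) = (2 * x - u, 2 * y - v).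
  by apply: uniqP; split; rewrite /= -?KP -?LP /=; ring.
have {uniqP LP} [ux vy] : u - x = 0 /\ v - y = 0 by split; lra.
have : 0 < r ^+ 2 by rewrite exprn_gt0.
by rewrite -KP /= ux vy expr0n addr0 ltxx.
Qed.

(** Squaring makes internal and external tangency satisfy the same equation.
    The reflection in the line of centers fixes the unique common point P, so
    the vectors from the two centers to P are parallel; the equation is the
    equality case of Cauchy-Schwarz for them. *)
Lemma touch_dist (R : rcfType) (K L : circle R) :
  0 < radius K -> touch K L ->
  (((center K).1 - (center L).1) ^+ 2 + ((center K).2 - (center L).2) ^+ 2
     - radius K ^+ 2 - radius L ^+ 2) ^+ 2
  = 4 * radius K ^+ 2 * radius L ^+ 2.
Proof.
move=> r_gt0 tKL; have := touch_center_neq r_gt0 tKL.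
case: K r_gt0 tKL => [[x y] r]; case: L => [[x' y'] r'].
rewrite /touch /on_circle /center /radius /= => r_gt0.
move=> [[u v] /= [[KP LP] uniqP]] neq.
set dx := x - x'; set dy := y - y'.
have d_neq0 : dx ^+ 2 + dy ^+ 2 != 0.
  rewrite paddr_eq0 ?sqr_ge0 // !sqrf_eq0 !subr_eq0.
  by apply/negP => /andP[/eqP ex /eqP ey]; apply: neq; rewrite ex ey.
(* [c] is the cross product of the vectors from the two centers to (u, v),
   and (u - s dy, v + s dx) the mirror image of (u, v) in the line of
   centers. *)
pose c := (u - x) * dy - (v - y) * dx.
pose s := 2 * c / (dx ^+ 2 + dy ^+ 2).
have es : s * (dx ^+ 2 + dy ^+ 2) = 2 * c by rewrite /s divfK.
have /pair_equal_spec[eu ev] : (u, v) = (u - s * dy, v + s * dx).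
  apply: uniqP; split; rewrite /= -?KP -?LP /=; apply/eqP;
    rewrite -subr_eq0; apply/eqP;
    transitivity (s * (s * (dx ^+ 2 + dy ^+ 2) - 2 * c)).
  - by rewrite /c; ring.
  - by rewrite es; ring.
  - by rewrite /c /dx /dy; ring.
  - by rewrite es; ring.
have sdx : s * dx = 0 by lra.
have sdy : s * dy = 0 by lra.
have c0 : c = 0.
  have : 2 * c = 0 by rewrite -es !expr2 mulrDr !mulrA sdx sdy !mul0r addr0.
  by lra.
apply/eqP; rewrite -subr_eq0 -KP -LP /=; apply/eqP.
transitivity (- 4 * c ^+ 2); first by rewrite /c /dx /dy; ring.
by rewrite c0; ring.
Qed.

(** * Circles touching two circles of a tangent pencil *)

(** As p varies over the nonzero scalars, these are the circles that touch one
    another and the vertical line x = t at the point (t, 0). *)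
Definition pencil_circle (R : rcfType) (t p : R) : circle R :=
  ((t + p, 0), `|p|).

Definition chain_ratio (R : rcfType) (p q w m : R) : R :=
  p * q / (p * q + m ^+ 2 * w ^+ 2).

(** The preimage, under inversion at (t, 0), of the circle of height m
    inscribed in the strip that comes from the pencil circles p and q.  The
    value w is either p - q or q - p; its sign is chosen according to which
    circle the chain starts from, so that [w * k] is the signed radius. *)
Definition chain_circle (R : rcfType) (t p q w m : R) : circle R :=
  let k := chain_ratio p q w m in
  ((t + (p + q) * k, 2 * m * (w * k)), `|w * k|).

(** The hypothesis excludes a zero denominator, the case of an inverted circle
    that passes through the base point and thus comes from a line. *)
Lemma chain_ratioE (R : rcfType) (p q w m : R) :
  chain_ratio p q w m != 0 ->
  m ^+ 2 * w ^+ 2 * chain_ratio p q w m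
  = p * q * (1 - chain_ratio p q w m).
Proof.
rewrite /chain_ratio => k_neq0.
have D_neq0 : p * q + m ^+ 2 * w ^+ 2 != 0.
  by apply: contraNneq k_neq0 => ->; rewrite invr0 mulr0.
rewrite [in RHS]mulrBr mulr1 -[X in _ = X - _](divfK D_neq0); ring.
Qed.

(** For a pencil circle p', tangency reads S = 2 p' (x - t + rho) with
    rho = r or rho = - r, where S is the power of the base point.  If p and q
    have the same sign of rho, then S = 0 and x - t = - rho, which forces y = 0;
    with opposite signs, the two equations give x - t, rho and S as multiples of
    one quantity k. *)
Lemma touch_pencil2 (R : rcfType) (t p q w : R) (K : circle R) :
  p * q != 0 -> w != 0 -> w ^+ 2 = (p - q) ^+ 2 -> 0 < radius K ->
  touch K (pencil_circle t p) -> touch K (pencil_circle t q) ->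
  (exists p', K = pencil_circle t p')
  \/ exists m, K = chain_circle t p q w m.
Proof.
move=> pq_neq0 w_neq0 ew r_gt0 /(touch_dist r_gt0) + /(touch_dist r_gt0).
case: K r_gt0 => [[x y] r]; rewrite /center /radius /= => r_gt0.
rewrite !real_normK ?num_real // => dp dq.
have [p_neq0 q_neq0] : p != 0 /\ q != 0.
  by apply/andP; move: pq_neq0; rewrite mulf_eq0 negb_or.
have pq_diff : p - q != 0 by rewrite -sqrf_eq0 -ew sqrf_eq0.
pose S := (x - t) ^+ 2 + y ^+ 2 - r ^+ 2.
have tangent p' : ((x - (t + p')) ^+ 2 + (y - 0) ^+ 2 - r ^+ 2 - p' ^+ 2) ^+ 2
    = 4 * r ^+ 2 * p' ^+ 2 ->
    S = 2 * p' * (x - t + r) \/ S = 2 * p' * (x - t - r).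
  move=> e; have : (S - 2 * p' * (x - t + r)) * (S - 2 * p' * (x - t - r)) = 0.
    apply/eqP; rewrite -(subrr (4 * r ^+ 2 * p' ^+ 2)) -{1}e /S.
    by apply/eqP; ring.
  by move/eqP; rewrite mulf_eq0 !subr_eq0 => /orP[] /eqP; [left | right].
have same rho : rho ^+ 2 = r ^+ 2 -> S = 2 * p * (x - t + rho) ->
    S = 2 * q * (x - t + rho) ->
    exists p', ((x, y), r) = pencil_circle t p'.
  move=> er Sp Sq.
  have : 2 * ((p - q) * (x - t + rho)) = 0.
    transitivity (2 * p * (x - t + rho) - 2 * q * (x - t + rho)); first by ring.
    by rewrite -Sp -Sq subrr.
  move/eqP; rewrite mulf_eq0 pnatr_eq0 /= mulf_eq0 (negPf pq_diff) /=.
  move=> /eqP xr.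
  have S0 : S = 0 by rewrite Sp xr mulr0.
  have y0 : y = 0.
    apply/eqP; rewrite -sqrf_eq0; apply/eqP.
    transitivity
      (S - ((x - t + rho) * (x - t - rho)) - (rho ^+ 2 - r ^+ 2)).
      by rewrite /S; ring.
    by rewrite S0 xr er; ring.
  exists (x - t); rewrite /pencil_circle y0; congr (_, _, _); first by ring.
  apply/eqP; rewrite -(@eqrXn2 _ 2) ?normr_ge0 ?ltW // real_normK ?num_real //.
  rewrite -er (_ : x - t = - rho) ?sqrrN //; lra.
have opposite rho : rho ^+ 2 = r ^+ 2 -> S = 2 * p * (x - t + rho) ->
    S = 2 * q * (x - t - rho) ->
    exists m, ((x, y), r) = chain_circle t p q w m.
  move=> er Sp Sq.
  pose k := S / (4 * (p * q)).
  have xp : x - t + rho = 2 * q * k.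
    by rewrite /k Sp; field; apply/andP.
  have xq : x - t - rho = 2 * p * k.
    by rewrite /k Sq; field; apply/andP.
  have ex : x = t + (p + q) * k by lra.
  have erho : rho = (q - p) * k by lra.
  have erk : r ^+ 2 = (w * k) ^+ 2.
    by rewrite -er erho [RHS]exprMn ew; ring.
  have wk_neq0 : w * k != 0.
    by rewrite -sqrf_eq0 -erk sqrf_eq0 gt_eqF.
  have k_neq0 : k != 0 by move: wk_neq0; rewrite mulf_eq0 negb_or => /andP[].
  have ey : y ^+ 2 = 4 * (p * q) * k * (1 - k).
    have Sk : S = 4 * (p * q) * k by rewrite Sp xp; ring.
    transitivity (S - (x - t) ^+ 2 + r ^+ 2); first by rewrite /S; ring.
    by rewrite Sk ex -er erho; ring.
  pose m := y / (2 * (w * k)).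
  have D : p * q + m ^+ 2 * w ^+ 2 = p * q / k.
    transitivity (p * q + y ^+ 2 / (4 * k ^+ 2)).
      by rewrite /m; field; rewrite k_neq0 w_neq0.
    by rewrite ey; field.
  have ek : chain_ratio p q w m = k.
    by rewrite /chain_ratio D; field; rewrite k_neq0 p_neq0 q_neq0.
  exists m; rewrite /chain_circle ek; congr (_, _, _) => //.
    by rewrite /m; field; rewrite k_neq0 w_neq0.
  apply/eqP; rewrite -(@eqrXn2 _ 2) ?normr_ge0 ?ltW // real_normK ?num_real //.
  by rewrite erk.
have rN : (- r) ^+ 2 = r ^+ 2 by rewrite sqrrN.
have [Sp|Sp] := tangent p dp; have [Sq|Sq] := tangent q dq.
- by left; apply: (same r).
- by right; apply: (opposite r).
- by right; apply: (opposite (- r)) => //; rewrite opprK.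
- by left; apply: (same (- r)).
Qed.

(** After inversion, a parallel to the sides of a strip touches a circle
    inscribed in it only if it is one of the sides. *)
Lemma chain_pencil_touch (R : rcfType) (t p q w m p' : R) :
  p * q != 0 -> w ^+ 2 = (p - q) ^+ 2 ->
  0 < radius (chain_circle t p q w m) ->
  touch (chain_circle t p q w m) (pencil_circle t p') ->
  p' = p \/ p' = q.
Proof.
move=> pq_neq0 ew r_gt0 /(touch_dist r_gt0).
move: r_gt0; rewrite /chain_circle /center /radius /= normr_gt0 mulf_eq0.
rewrite negb_or.
case/andP=> w_neq0 k_neq0; have := chain_ratioE k_neq0.
move: (chain_ratio _ _ _ _) k_neq0 => k k_neq0 ek.
rewrite !real_normK ?num_real // => dist.
have Sk : ((p + q) * k) ^+ 2 + (2 * m * (w * k)) ^+ 2 - (w * k) ^+ 2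
    = 4 * (p * q) * k.
  transitivity (((p + q) ^+ 2 - w ^+ 2) * k ^+ 2
                + 4 * k * (m ^+ 2 * w ^+ 2 * k)); first by ring.
  by rewrite ek ew; ring.
have : 16 * (p * q) * k ^+ 2 * ((p' - p) * (p' - q)) = 0.
  transitivity ((4 * (p * q) * k - 2 * p' * ((p + q) * k)) ^+ 2
                - 4 * (w ^+ 2 * k ^+ 2) * p' ^+ 2); first by rewrite ew; ring.
  apply/eqP; rewrite subr_eq0 -exprMn -dist -Sk; apply/eqP; ring.
move/eqP; rewrite mulf_eq0 mulf_eq0 sqrf_eq0 (negPf k_neq0) orbF.
rewrite mulf_eq0 (negPf pq_neq0) pnatr_eq0 /= mulf_eq0 !subr_eq0.
by case/orP=> /eqP; [left | right].
Qed.

(** The squared tangency equation reduces to N (N - 1) = 0 for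
    N = (m - m')^2, and N = 0 would make the two circles equal. *)
Lemma chain_circle_touch (R : rcfType) (t p q w m m' : R) :
  p * q != 0 -> w ^+ 2 = (p - q) ^+ 2 ->
  0 < radius (chain_circle t p q w m) ->
  0 < radius (chain_circle t p q w m') ->
  touch (chain_circle t p q w m) (chain_circle t p q w m') ->
  m' = m + 1 \/ m' = m - 1.
Proof.
move=> pq_neq0 ew r_gt0 r'_gt0 tangent.
have m_neq : m' != m.
  apply/eqP => em; rewrite em in tangent.
  exact: touch_center_neq r_gt0 tangent erefl.
move: tangent => /(touch_dist r_gt0); move: r_gt0 r'_gt0.
rewrite /chain_circle /center /radius /= !normr_gt0 !(mulf_eq0 w) !negb_or.
case/andP=> w_neq0 k_neq0 /andP[_ k'_neq0].
have := chain_ratioE k'_neq0; have := chain_ratioE k_neq0.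
move: (chain_ratio _ _ _ m') k'_neq0 => k' k'_neq0.
move: (chain_ratio _ _ _ m) k_neq0 => k k_neq0 ek ek'.
rewrite !real_normK ?num_real // => dist.
pose N := (m - m') ^+ 2.
have dE : (t + (p + q) * k - (t + (p + q) * k')) ^+ 2
    + (2 * m * (w * k) - 2 * m' * (w * k')) ^+ 2
    - (w * k) ^+ 2 - (w * k') ^+ 2
    = (4 * N - 2) * (w ^+ 2 * k * k').
  transitivity (((p + q) ^+ 2 - w ^+ 2) * (k - k') ^+ 2 - 2 * w ^+ 2 * k * k'
    + 4 * (k - k') * (m ^+ 2 * w ^+ 2 * k)
    - 4 * (k - k') * (m' ^+ 2 * w ^+ 2 * k')
    + 4 * N * (w ^+ 2 * k * k')); first by rewrite /N; ring.
  by rewrite ek ek' ew; ring.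
have : 16 * (w ^+ 2 * k * k') ^+ 2 * (N * (N - 1)) = 0.
  transitivity (((4 * N - 2) * (w ^+ 2 * k * k')) ^+ 2
                - 4 * (w * k) ^+ 2 * (w * k') ^+ 2); first by ring.
  by rewrite -dE dist subrr.
have wkk_neq0 : w ^+ 2 * k * k' != 0 by rewrite !mulf_neq0 ?sqrf_eq0.
move/eqP; rewrite mulf_eq0 mulf_eq0 pnatr_eq0 /= sqrf_eq0 (negPf wkk_neq0) /=.
rewrite (mulf_eq0 N) sqrf_eq0 !subr_eq0 eq_sym (negPf m_neq) /= sqrf_eq1.
by case/orP=> /eqP h; [right | left]; lra.
Qed.

(** * The chain is indexed by height *)

Lemma chain_neighbour (R : rcfType) (t p q w m : R) (K L : circle R) :
  p * q != 0 -> w != 0 -> w ^+ 2 = (p - q) ^+ 2 ->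
  0 < radius K -> 0 < radius L ->
  touch L (pencil_circle t p) -> touch L (pencil_circle t q) ->
  touch K L -> K = chain_circle t p q w m ->
  L = chain_circle t p q w (m + 1) \/ L = chain_circle t p q w (m - 1).
Proof.
move=> pq_neq0 w_neq0 ew K_gt0 L_gt0 Lp Lq KL eK; subst K.
have [[p' eL]|[m' eL]] := touch_pencil2 pq_neq0 w_neq0 ew L_gt0 Lp Lq.
- subst L; exfalso.
  have [ep|ep] := chain_pencil_touch pq_neq0 ew K_gt0 KL; subst p'.
    exact: touch_center_neq L_gt0 Lp erefl.
  exact: touch_center_neq L_gt0 Lq erefl.
- subst L.
  have [->|->] := chain_circle_touch pq_neq0 ew K_gt0 L_gt0 KL.
    by left.
  by right.
Qed.

Lemma int_two_sided_ind (P : int -> Prop) :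
  P 0 -> (forall n, P n -> P (n + 1)) -> (forall n, P (n + 1) -> P n) ->
  forall n, P n.
Proof.
move=> P0 Pup Pdown; elim/int_ind => // n Pn.
  by rewrite -addn1 PoszD; apply: Pup.
by apply: Pdown; rewrite -addn1 PoszD opprD subrK.
Qed.

(** When p q < 0 (the chain starting at gamma), the signed radius is negative
    at m = 0, where the circle surrounds the two others; from |m| = 1 on, the
    bound p q + w^2 = p^2 + q^2 - p q > 0 makes it positive. *)
Lemma chain_signed_radius_gt0 (R : rcfType) (p q w m : R) :
  w ^+ 2 = (p - q) ^+ 2 -> 0 < p * q * w -> 0 < p * q \/ 1 <= m ^+ 2 ->
  0 < w * chain_ratio p q w m.
Proof.
move=> ew pqw_gt0 hm; rewrite /chain_ratio mulrA (mulrC w) divr_gt0 //.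
have [pq_gt0|pq_le0] := ltP 0 (p * q).
  by rewrite ltr_wpDr // mulr_ge0 // sqr_ge0.
have m_ge1 : 1 <= m ^+ 2 by case: hm => //; rewrite ltNge pq_le0.
have pq_neq0 : p * q != 0.
  by apply: contraTneq pqw_gt0 => ->; rewrite mul0r ltxx.
have pq_lt0 : p * q < 0 by rewrite lt_neqAle pq_neq0.
have : w ^+ 2 <= m ^+ 2 * w ^+ 2 by rewrite ler_peMl ?sqr_ge0.
have := sqr_ge0 p; have := sqr_ge0 q.
have : w ^+ 2 = p ^+ 2 + q ^+ 2 - 2 * (p * q) by rewrite ew; ring.
lra.
Qed.

(** Two consecutive members determine the next one on either side: of the two
    neighbours, one is already taken and members are distinct.  The sign of the
    ordinate of delta_1 fixes the direction of the first step: since p q w > 0,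
    the ordinate 2 m w k has the sign of m for m = 1 and m = - 1. *)
Lemma tangency_chainE (R : rcfType) (t p q w : R) (delta : int -> circle R) :
  w ^+ 2 = (p - q) ^+ 2 -> 0 < p * q * w ->
  (forall n, 0 < radius (delta n)) -> injective delta ->
  delta 0 = chain_circle t p q w 0 ->
  (forall n, touch (delta n) (pencil_circle t p)) ->
  (forall n, touch (delta n) (pencil_circle t q)) ->
  (forall n, touch (delta n) (delta (n + 1))) ->
  0 < (center (delta 1)).2 ->
  forall n, delta n = chain_circle t p q w n%:~R.
Proof.
move=> ew pqw_gt0 r_gt0 inj d0 dp dq dd y1_gt0.
have /andP[pq_neq0 w_neq0] : (p * q != 0) && (w != 0).
  by rewrite -negb_or -mulf_eq0 gt_eqF.
have d1 : delta (0 + 1) = chain_circle t p q w (0 + 1)%:~R.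
  have [->|] := chain_neighbour pq_neq0 w_neq0 ew (r_gt0 0) (r_gt0 (0 + 1))
    (dp _) (dq _) (dd 0) d0; first by rewrite !add0r.
  rewrite !add0r => d1; move: y1_gt0; rewrite {}d1 /center /=.
  have : 0 < w * chain_ratio p q w (-1).
    by apply: chain_signed_radius_gt0 => //; right; rewrite sqrrN expr1n.
  by move=> wk_gt0; rewrite mulrN1 mulNr oppr_gt0 pmulr_rlt0 // ltNge ltW.
suff H n : delta n = chain_circle t p q w n%:~R
    /\ delta (n + 1) = chain_circle t p q w (n + 1)%:~R.
  by move=> n; have [] := H n.
elim/int_two_sided_ind: n => [//|n [dn dn1]|n [dn1 dn2]]; split=> //.
  have [->|] := chain_neighbour pq_neq0 w_neq0 ew (r_gt0 _) (r_gt0 (n + 1 + 1))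
    (dp _) (dq _) (dd _) dn1; first by rewrite [in RHS]rmorphD.
  by rewrite rmorphD /= addrK -dn => /inj; lia.
have [|->] := chain_neighbour pq_neq0 w_neq0 ew (r_gt0 _) (r_gt0 n)
  (dp _) (dq _) (touch_sym (dd n)) dn1; last by rewrite rmorphD /= addrK.
have -> : (n + 1)%:~R + 1 = (n + 1 + 1)%:~R :> R by rewrite [in RHS]rmorphD.
by rewrite -dn2 => /inj; lia.
Qed.

(** * The line of centers and the signed radius *)

(** The ordinate of H is an affine function [height] of the ratio k_n; since
    x_n is affine in k_n too, the points (x_m, height k_m) are collinear, and
    those with m = i, j are the two centers. *)
Lemma chain_offset (R : rcfType) (t p q w : R) (delta : int -> circle R)
    (i j n : int) :
  w != 0 -> p + q != 0 ->
  (forall n, 0 < radius (delta n)) ->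
  (forall n, delta n = chain_circle t p q w n%:~R) ->
  i <> j -> i + j <> 0 ->
  exists H : point R,
    is_H delta i j n H /\
    signed_dist delta n H
    = chain_coef R i j n * (w * chain_ratio p q w n%:~R).
Proof.
move=> w_neq0 pq_sum r_gt0 dE hij hsum.
have k_neq0 m : chain_ratio p q w m%:~R != 0.
  have := r_gt0 m; rewrite dE /radius /= normr_gt0 mulf_eq0 negb_or.
  by case/andP.
have kE m := chain_ratioE (k_neq0 m).
pose k m := chain_ratio p q w m%:~R.
pose I : R := i%:~R; pose J : R := j%:~R.
have IJ_sum : I + J != 0 by rewrite -rmorphD intr_eq0; apply/eqP.
have IJ_diff : J - I != 0.
  by rewrite -rmorphB intr_eq0 subr_eq0; apply/eqP => e; apply: hij.
have k_diff : k j - k i != 0.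
  apply/negP => /eqP/subr0_eq ek.
  have : (J - I) * (I + J) * (w ^+ 2 * k j) = 0.
    transitivity (J ^+ 2 * w ^+ 2 * k j - I ^+ 2 * w ^+ 2 * k j); first by ring.
    by rewrite {2}ek /I /J /k !kE -/(k i) -/(k j) ek subrr.
  apply/eqP; apply: mulf_neq0; apply: mulf_neq0; rewrite ?sqrf_eq0 //.
  exact: k_neq0.
pose slope := 2 * w / (I + J) * (I * J - p * q / w ^+ 2).
pose height kk := 2 * (p * q) / (w * (I + J)) + slope * kk.
have heightE m : height (k m) = 2 * w / (I + J) * (m%:~R ^+ 2 + I * J) * k m.
  transitivity (2 / (w * (I + J)) *
      (p * q * (1 - k m) + w ^+ 2 * (I * J) * k m)).
    by rewrite /height /slope; field; rewrite w_neq0 IJ_sum.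
  by rewrite /k -kE; field; rewrite w_neq0 IJ_sum.
have yi : 2 * I * (w * k i) = height (k i) by rewrite heightE -/I; field.
have yj : 2 * J * (w * k j) = height (k j) by rewrite heightE -/J; field.
exists (t + (p + q) * k n, height (k n)); split; last first.
  rewrite /signed_dist /chain_coef dE /center /= heightE.
  by rewrite !rmorphM !rmorphB rmorphD /= -/I -/J -/(k n); field.
case=> u v; rewrite !dE /on_line /center /= -/I -/J.
rewrite -/(k i) -/(k j) -/(k n) yi yj.
have common : (p + q) * (k j - k i) != 0 by rewrite mulf_neq0.
split=> [[online xn]|[-> ->]]; last by split=> //; rewrite /height; ring.
rewrite xn in online *; congr (_, _); apply: (mulfI common).
transitivity ((t + (p + q) * k j - (t + (p + q) * k i)) * (v - height (k i))
              + (p + q) * (k j - k i) * height (k i)); first by ring.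
by rewrite online /height; ring.
Qed.

(** The only member of any of the chains that equals gamma is delta_0 of the
    chain starting at gamma, because in the two other chains every member
    touches gamma and no circle touches itself. *)
Lemma chain_radiusE (R : rcfType) (a b t p q w : R) (e : arbelos_label)
    (delta : int -> circle R) (n : int) :
  is_chain a b e delta -> w ^+ 2 = (p - q) ^+ 2 -> 0 < p * q * w ->
  (e = Gamma -> w = - (a + b)) -> (e <> Gamma -> 0 < p * q) ->
  (forall n, delta n = chain_circle t p q w n%:~R) ->
  chain_radius a b delta n = w * chain_ratio p q w n%:~R.
Proof.
move=> [[r_gt0 inj] d0 tangent _ _] ew pqw_gt0 wG pq_gt0 dE.
have pq_neq0 : p * q != 0.
  by apply: contraTneq pqw_gt0 => ->; rewrite mul0r ltxx.
rewrite /chain_radius; case: eqP => [dnG|dnG].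
  have eG : e = Gamma.
    case: e tangent {d0 wG pq_gt0} => // tangent;
      have tG : touch (delta n) (arbelos_circle a b Gamma) by exact: tangent.
    - by have := touch_center_neq (r_gt0 n) tG; rewrite dnG.
    - by have := touch_center_neq (r_gt0 n) tG; rewrite dnG.
  have -> : n = 0 by apply: inj; rewrite dnG d0 eG.
  by rewrite d0 eG wG // /chain_ratio expr0n /= mul0r addr0 divff // mulr1.
rewrite dE /radius /= gtr0_norm //; apply: chain_signed_radius_gt0 => //.
have [n0|n_neq0] := eqVneq n 0; last first.
  by right; rewrite -rmorphXn /= ler1z; nia.
by left; apply: pq_gt0 => eG; apply: dnG; rewrite n0 d0 eG.
Qed.

(* For a = b all centers of the chain starting at gamma lie on the line x = 0,
   so l_{i,j} coincides with x = x_n and H_{i,j}(n) does not exist. *)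
Theorem theorem2 (R : rcfType) (a b : R) (ha : 0 < a) (hb : 0 < b)
    (e : arbelos_label) (delta : int -> circle R)
    (hdelta : is_chain a b e delta)
    (i j n : int) (hij : i <> j)
    (hab : e = Gamma -> a <> b)
    (hsum : i + j <> 0) :
  exists H : point R,
    is_H delta i j n H /\
    signed_dist delta n H = chain_coef R i j n * chain_radius a b delta n.
Proof.
have [[r_gt0 inj] d0 tangent dd y1_gt0] := hdelta.
(* [base] is the abscissa of A, B or C, where the two other circles touch. *)
pose base := match e with Alpha => - 2 * b | Beta => 2 * a | Gamma => 0 end.
pose p := match e with Alpha => b | Beta => - a | Gamma => a end.
pose q := match e with Alpha => a + b | Beta => - (a + b) | Gamma => - b end.
pose w := match e with Alpha => a | Beta => b | Gamma => - (a + b) end.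
have c_gt0 : 0 < a + b by rewrite addr_gt0.
have ew : w ^+ 2 = (p - q) ^+ 2 by rewrite /w /p /q; case: (e); ring.
have pqw_gt0 : 0 < p * q * w.
  rewrite /w /p /q; case: (e);
    by rewrite ?mulrNN ?(mulrN, mulNr, opprK) !mulr_gt0.
have w_neq0 : w != 0.
  by rewrite /w; case: (e); rewrite ?oppr_eq0 gt_eqF.
have pq_sum : p + q != 0.
  rewrite /p /q; move: hab; case: (e) => hab.
  - by rewrite gt_eqF // addr_gt0.
  - by rewrite -opprD oppr_eq0 gt_eqF // addr_gt0.
  - by rewrite subr_eq0; apply/eqP/hab.
have dE : forall n, delta n = chain_circle base p q w n%:~R.
  apply: tangency_chainE => // [|m|m].
  - rewrite d0 /chain_circle /chain_ratio expr0n /= mul0r addr0.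
    rewrite divff; last first.
      by apply: contraTneq pqw_gt0 => ->; rewrite mul0r ltxx.
    rewrite mulr0 mulr1 mulr1 mul0r; rewrite /w /p /q /base; case: (e) => /=;
      by rewrite ?normrN gtr0_norm //; congr (_, _, _); ring.
  - have -> : pencil_circle base p
        = arbelos_circle a b (match e with Alpha => Beta | _ => Alpha end).
      rewrite /pencil_circle /base /p; case: (e) => /=;
        by rewrite ?normrN gtr0_norm //; congr (_, _, _); ring.
    by apply: tangent; case: (e).
  have -> : pencil_circle base q
      = arbelos_circle a b (match e with Gamma => Beta | _ => Gamma end).
    rewrite /pencil_circle /base /q; case: (e) => /=;
      by rewrite ?normrN gtr0_norm //; congr (_, _, _); ring.
  by apply: tangent; case: (e).
have [H [isH HE]] := chain_offset n w_neq0 pq_sum r_gt0 dE hij hsum.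
exists H; split=> //; rewrite HE; congr (_ * _).
symmetry; apply: (chain_radiusE _ hdelta ew pqw_gt0 _ _ dE).
- by rewrite /w => ->.
- rewrite /p /q; case: (e) => // _; rewrite ?mulrNN mulr_gt0 //.
Qed.
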